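(* Suppose that the nodal prices are capped at a finite Value of Lost Load $\mathrm{VOLL}$, i.e. $\lambda_n(\omega)\le \mathrm{VOLL}$ for all nodes $n\in\mathcal{N}$ and all scenarios $\omega\in\Omega$. Then the risk-averse competitive equilibrium problem RAEQ (defined by the collection of the problems $\mathrm{PISO}(\omega)$, $\mathrm{MC}(\omega)$ for $\omega\in\Omega$ and $\mathrm{RAP}(i)$ for all generators $i$) admits a solution.
   Context: $\Omega$ is a finite sample space of scenarios; $\mathcal{N}$ is the finite set of nodes of a network; $\mathcal{T}(n)$ is the set of generators located at node $n$, and $j(i)$ is the node of generator $i$. $\mathcal{F}$ is a closed, convex, bounded and non-empty set of flow vectors (obeying thermal limits, line capacities and DC load-flow constraints). $\tau_n(F)$ is the net energy injected from the grid into node $n$ under flow $F$, a linear function of $F$. For generator $i$: $c_i$ is the marginal generation cost, $G_i(\omega)\ge0$ the capacity in scenario $\omega$, and $r_{u,i},r_{v,i}\ge0$ the marginal costs of upward and downward deviation (positive for some generator). $D_n(\omega)$ is the inelastic demand at node $n$ in scenario $\omega$. Each generator $i$ is endowed with a coherent risk measure, given by its dual representation via a closed convex non-empty set $\mathcal{D}_i$ of probability measures on $\Omega$: the risk-adjusted value of a random profit $Z$ is $\min_{\mu\in\mathcal{D}_i}\mathbb{E}_\mu[Z]$ (equivalently, the risk-adjusted disbenefit is $\max_{\mu\in\mathcal{D}_i}\mathbb{E}_\mu[-Z]$). The agents' problems are: - $\mathrm{PISO}(\omega)$ (system operator): given prices $\lambda(\omega)$, choose $F(\omega)\in\mathcal{F}$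 to maximize $\sum_n\lambda_n(\omega)\tau_n(F(\omega))$. - $\mathrm{MC}(\omega)$ (market clearing agent): given $X(\omega),F(\omega)$, choose prices $\lambda_n(\omega)\ge0$, $n\in\mathcal{N}$ (with the price cap: $0\le\lambda_n(\omega)\le\mathrm{VOLL}$) to maximize $-\sum_n\lambda_n(\omega)\big(\sum_{i\in\mathcal{T}(n)}X_i(\omega)+\tau_n(F(\omega))-D_n(\omega)\big)$. - $\mathrm{RAP}(i)$ (price-taking risk-averse generator): given prices, choose $x_i$ and $(X_i(\omega),U_i(\omega),V_i(\omega))_{\omega\in\Omega}$ to maximize the risk-adjusted value (with respect to $\mathcal{D}_i$) of the random profit $(\lambda_{j(i)}(\omega)-c_i)X_i(\omega)-r_{u,i}U_i(\omega)-r_{v,i}V_i(\omega)$, subject to $x_i+U_i(\omega)-V_i(\omega)=X_i(\omega)$, $0\le X_i(\omega)\le G_i(\omega)$, $U_i(\omega),V_i(\omega)\ge0$ for all $\omega$, and $x_i\ge0$. A solution of RAEQ is a choice of all these variables such that each agent's variables solve that agent's problem given the variables of the other agents. *)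

(* Defs.v *)
From mathcomp Require Export all_boot all_order all_algebra.
From mathcomp Require Export all_classical all_reals all_analysis.
Set Implicit Arguments.
Unset Strict Implicit.
Unset Printing Implicit Defensive.
Import Order.TTheory GRing.Theory Num.Theory numFieldNormedType.Exports.
Local Open Scope classical_set_scope.
Local Open Scope ring_scope.

Definition maximizes (R : realType) (S : Type) (A : set S) (f : S -> R)
    (s : S) : Prop :=
  A s /\ forall s', A s' -> f s' <= f s.

Definition prob_measures (R : realType) (Omega : finType) :
    set (Omega -> R) :=
  [set mu | (forall w, 0 <= mu w) /\ \sum_w mu w = 1].

Definition expect (R : realType) (Omega : finType) (mu Z : Omega -> R) : R :=
  \sum_w mu w * Z w.

(* The infimum is a minimum for the risk sets considered here, which are
   closed and non-empty sets of probability measures: see risk_value_min. *)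
Definition risk_value (R : realType) (Omega : finType)
    (Q : set (Omega -> R)) (Z : Omega -> R) : R :=
  inf [set expect mu Z | mu in Q].

Lemma risk_value_min (R : realType) (Omega : finType)
    (Q : set (Omega -> R)) (Z : Omega -> R) :
  Q !=set0 -> closed (Q : set {ptws Omega -> R}) ->
  Q `<=` @prob_measures R Omega ->
  exists2 mu, Q mu & risk_value Q Z = expect mu Z /\
    forall nu, Q nu -> expect mu Z <= expect nu Z.
Proof.
move=> Q0 Qcl Qpr.
have Qco : compact (Q : set {ptws Omega -> R}).
  apply: (@subclosed_compact _ _
    [set f : {ptws Omega -> R} | forall w, `[0, 1]%classic (f w)]) => //.
    exact: (@tychonoff Omega (fun=> R) (fun=> `[0, 1]%classic)
      (fun=> @segment_compact _ _ _)).
  move=> mu /Qpr [mu0 mu1] w /=; rewrite in_itv /= mu0 /= -mu1.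
  by rewrite (bigD1 w) //= lerDl sumr_ge0.
have Ects : continuous ((fun mu => expect mu Z) : {ptws Omega -> R} -> R).
  apply: (@continuous_big R Omega +%R 0 xpredT (@add_continuous R)
    {ptws Omega -> R} (index_enum Omega) (fun w mu => mu w * Z w)) => w _ mu.
  apply: (@cvgMr_tmp _ {ptws Omega -> R} (nbhs mu) _ (fun mu => mu w)).
  exact: (@proj_continuous _ (fun _ : Omega => R) w mu).
have [|mu /set_mem Qmu mumin] :=
    @compact_EVT_min {ptws Omega -> R} R (fun mu => expect mu Z) Q Q0 Qco.
  exact: continuous_subspaceT.
exists mu => //; split=> [|nu Qnu]; last by apply: mumin; rewrite inE.
apply/eqP; rewrite eq_le; apply/andP; split.
  apply: ge_inf; last by exists mu.
  by exists (expect mu Z) => _ [nu Qnu <-]; apply: mumin; rewrite inE.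
apply: lb_le_inf; first by exists (expect mu Z), mu.
by move=> _ [nu Qnu <-]; apply: mumin; rewrite inE.
Qed.

Definition PISO (R : realType) (Node : finType) (m : nat)
    (flows : set 'rV[R]_m) (tau : Node -> {linear 'rV[R]_m -> R^o})
    (lam : Node -> R) (F : 'rV[R]_m) : Prop :=
  maximizes flows (fun F' => \sum_n lam n * tau n F') F.

Definition MC (R : realType) (Node Gen : finType) (j : Gen -> Node) (m : nat)
    (tau : Node -> {linear 'rV[R]_m -> R^o}) (D : Node -> R) (VOLL : R)
    (X : Gen -> R) (F : 'rV[R]_m) (lam : Node -> R) : Prop :=
  maximizes [set l : Node -> R | forall n, 0 <= l n <= VOLL]
    (fun l => - \sum_n l n * ((\sum_(i | j i == n) X i) + tau n F - D n)) lam.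

Record plan (R : realType) (Omega : finType) := Plan {
  setpoint : R;
  dispatch : Omega -> R;
  up_dev : Omega -> R;
  down_dev : Omega -> R
}.

Definition feasible_plan (R : realType) (Omega : finType) (G : Omega -> R) :
    set (plan R Omega) :=
  [set p | 0 <= setpoint p /\ forall w,
    [/\ setpoint p + up_dev p w - down_dev p w = dispatch p w,
        0 <= dispatch p w <= G w, 0 <= up_dev p w & 0 <= down_dev p w]].

(* price is the nodal price at the node of the generator *)
Definition profit (R : realType) (Omega : finType) (c ru rv : R)
    (price : Omega -> R) (p : plan R Omega) (w : Omega) : R :=
  (price w - c) * dispatch p w - ru * up_dev p w - rv * down_dev p w.

Definition RAP (R : realType) (Omega : finType) (c ru rv : R) (G : Omega -> R)
    (Q : set (Omega -> R)) (price : Omega -> R) (p : plan R Omega) : Prop :=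
  maximizes (feasible_plan G)
    (fun p' => risk_value Q (profit c ru rv price p')) p.

Definition RAEQ_solution (R : realType) (Omega Node Gen : finType)
    (j : Gen -> Node) (m : nat)
    (flows : set 'rV[R]_m) (tau : Node -> {linear 'rV[R]_m -> R^o})
    (c ru rv : Gen -> R) (G : Gen -> Omega -> R) (D : Node -> Omega -> R)
    (Q : Gen -> set (Omega -> R)) (VOLL : R)
    (F : Omega -> 'rV[R]_m) (lam : Node -> Omega -> R)
    (p : Gen -> plan R Omega) : Prop :=
  [/\ forall w, PISO flows tau (lam^~ w) (F w),
      forall w, MC j tau (D^~ w) VOLL (fun i => dispatch (p i) w) (F w)
                   (lam^~ w)
    & forall i, RAP (c i) (ru i) (rv i) (G i) (Q i) (lam (j i)) (p i)].

(* Main.v *)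
Require Import Defs.
From mathcomp Require Import ring lra zify.
Import Order.TTheory GRing.Theory Num.Theory numFieldNormedType.Exports.
Set Implicit Arguments.
Unset Strict Implicit.
Unset Printing Implicit Defensive.

(** An equilibrium is a Nash equilibrium of a game in which the system operator
    picks flows, the market picks capped prices and every generator picks a
    plan, so existence is a fixed-point statement. It is obtained from Ky Fan's
    minimax inequality [ky_fan] applied to the Nikaido-Isoda function
    [gain a b]: the sum, over all agents, of what the agent would gain by moving
    from its part of the profile a to its part of the profile b while all others
    stay at a. This function is continuous in a, concave in b and zero when
    b = a, so some feasible a satisfies gain a b <= 0 for every feasible b;
    testing this against deviations of one agent shows that a is an equilibrium
    ([equilibrium_of_gain]).

    Ky Fan's inequality asks for compact strategy sets, and the plans of a
    generator are unbounded. But deviations are only costly, so a generator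
    loses nothing by taking the upward and the downward deviation to be the
    positive and the negative part of dispatch minus setpoint, and by capping
    the setpoint at its total capacity over all scenarios
    ([plan_of_dominates]). What remains to be chosen is a bounded setpoint and a
    bounded dispatch; the profit is concave in these. The risk-adjusted value is
    a minimum of expectations, hence monotone, concave and Lipschitz, and this
    carries over concavity and continuity from profits to utilities.

    As for Ky Fan's inequality, compactness reduces it to finitely many test
    points y_i; on the simplex of their convex combinations
    it becomes the statement that closed sets F_i which cover the simplex and
    are such that F_i contains the face x_i = 0 have a common point
    ([dual_KKM]). Such a point is a limit of points of finer and finer grids,
    each near all the F_i. On a grid, that is a combinatorial statement
    ([scarf_grid]), a consequence of Scarf's theorem on primitive sets, [scarf].
    The latter is proved by a parity argument that needs no triangulation: only
    one linear order of the grid per coordinate. *)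

(** * Scarf's theorem on primitive sets *)

(** Exactly one pair of elements of A is identified by f; its two members are
    the elements that can be dropped. The lemma serves twice in the parity
    count, once for the colouring of a room and once for the map that sends an
    index to the lowest element of a door. *)
Lemma card_redundant (X Y : finType) (f : X -> Y) (A : {set X}) :
  #|A| = #|f @: A|.+1 -> #|[set k in A | f @: (A :\ k) == f @: A]| = 2.
Proof.
move=> cardA.
have [inj|] := boolP (dinjectiveb f A).
  by move: cardA; rewrite card_in_imset; [lia | exact/dinjectiveP].
move=> /dinjectivePn[k1 k1A [k2]]; rewrite !inE => /andP[k2k1 k2A] fk.
have redundant k : k \in A -> forall l, l \in A -> l != k -> f k = f l ->
    f @: (A :\ k) == f @: A.
  move=> kA l lA lk fkl; apply/eqP/setP => y; apply/imsetP/imsetP => -[x].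
    by rewrite !inE => /andP[_ xA] ->; exists x.
  move=> xA ->; have [->|xk] := eqVneq x k; last by exists x; rewrite ?inE ?xk.
  by exists l; rewrite // !inE lk.
suff -> : [set k in A | f @: (A :\ k) == f @: A] = [set k1; k2].
  by rewrite cards2 eq_sym k2k1.
apply/setP => k; rewrite !inE; apply/andP/orP => [[kA /eqP fA]|]; last first.
  case=> /eqP->; split=> //; first exact: (redundant _ _ k2).
  by apply: (redundant _ _ k1); rewrite 1?eq_sym.
have inj : {in A :\ k &, injective f}.
  by apply/imset_injP; rewrite fA; move: cardA; rewrite (cardsD1 k) kA; lia.
apply/orP/negPn/negP; rewrite negb_or => /andP[kk1 kk2].
have := inj k1 k2; rewrite !inE ![_ == k]eq_sym kk1 kk2 k1A k2A fk.
by move=> /(_ isT isT erefl) e; rewrite e eqxx in k2k1.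
Qed.

(** The finite set V carries one linear order for each index i, given by the
    injective rank [rk i]. A room is a dominant set of cardinal #|I|, and a door
    is a set with one element fewer. Each index i has a slack [e i], which is
    last in the order i and above all ordinary elements (those that are not
    slacks) in the other orders; slacks play the part of the facets of a
    simplex. *)
Section Scarf.
Variables (I V : finType) (rk : I -> V -> nat).
Hypothesis rk_inj : forall i, injective (rk i).

(** Scarf's primitive sets are the dominant sets of cardinal #|I|. *)
Definition dominant (S : {set V}) :=
  [forall y, exists i, forall x in S, rk i y <= rk i x].

Lemma dominantP (S : {set V}) :
  reflect (forall y, exists i, forall x, x \in S -> rk i y <= rk i x)
          (dominant S).
Proof.
apply: (iffP forallP) => dom y; first have /existsP[i /forall_inP] := dom y.
  by exists i.
by have [i le_y] := dom y; apply/existsP; exists i; apply/forall_inP.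
Qed.

Lemma dominant_sub (S S' : {set V}) :
  S' \subset S -> dominant S -> dominant S'.
Proof.
move=> /fintype.subsetP sub /dominantP dom; apply/dominantP => y.
by have [i le_y] := dom y; exists i => x /sub; apply: le_y.
Qed.

Definition lowest (v0 : V) (S : {set V}) (i : I) : V :=
  [arg min_(x < v0 in S) rk i x].

Lemma lowestP v0 (S : {set V}) i : v0 \in S ->
  lowest v0 S i \in S /\ forall x, x \in S -> rk i (lowest v0 S i) <= rk i x.
Proof. by move=> v0S; rewrite /lowest; case: arg_minnP. Qed.

(** A member of S that is lowest in no order would itself violate dominance. *)
Lemma lowest_imset v0 (S : {set V}) :
  v0 \in S -> dominant S -> lowest v0 S @: [set: I] = S.
Proof.
move=> v0S /dominantP dom; apply/setP => y; apply/imsetP/idP => [[i _ ->]|yS].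
  by case: (lowestP i v0S).
have [i le_y] := dom y; exists i => //; have [lowS low] := lowestP i v0S.
by apply: (@rk_inj i); apply/eqP; rewrite eqn_leq le_y //= low.
Qed.

Variable e : I -> V.
Hypothesis e_low : forall i y, rk i (e i) <= rk i y.
Hypothesis e_high : forall i j y, j != i -> y \notin codom e ->
  rk i y < rk i (e j).

Lemma e_inj v0 : v0 \notin codom e -> injective e.
Proof.
move=> v0e i j eij; apply/eqP; apply/negPn/negP => ij.
by have := e_high ij v0e; rewrite eij ltnNge e_low.
Qed.

(** A door has one element fewer than there are indices, so exactly two indices
    k1, k2 have their lowest element taken over by another index as well.
    A new element of a room has to be the lowest one for k1 or for k2, it has to
    lie above the door in all other orders, and dominance forces it to be the
    greatest such element in the order of k1 or k2. This gives one room for each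
    of the two. *)
Lemma card_fill (S : {set V}) v0 :
  v0 \in S -> v0 \notin codom e -> dominant S -> #|I| = #|S|.+1 ->
  #|[set v | (v \notin S) && dominant (v |: S)]| = 2.
Proof.
move=> v0S v0e Sdom cardI.
pose f := lowest v0 S.
have fS i : f i \in S by case: (lowestP i v0S).
have fle i x : x \in S -> rk i (f i) <= rk i x.
  by case: (lowestP i v0S) => _; apply.
have fimg : f @: [set: I] = S by exact: lowest_imset.
pose K := [set k in [set: I] | f @: ([set: I] :\ k) == f @: [set: I]].
have cardK : #|K| = 2 by apply: card_redundant; rewrite fimg cardsT.
(* the candidates for a new element that is lowest in the order k *)
pose M k := [set y | [forall i, (i != k) ==> (rk i (f i) < rk i y)]].
have MP k y : reflect (forall i, i != k -> rk i (f i) < rk i y) (y \in M k).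
  by rewrite inE; apply: (iffP forall_inP).
have KP k : k \in K -> forall x, x \in S -> exists2 i, i != k & x = f i.
  rewrite inE fimg => /andP[_ /eqP Sk] x; rewrite -Sk => /imsetP[i].
  by rewrite !inE andbT; exists i.
have MS k y : k \in K -> y \in M k -> y \notin S.
  move=> kK /MP yM; apply/negP => /(KP k kK)[i ik yfi].
  by have := yM i ik; rewrite yfi ltnn.
have Mk k y : k \in K -> y \in M k -> rk k y < rk k (f k).
  move=> kK yM; have /dominantP/(_ y)[i le_y] := Sdom.
  have [ik|ik] := eqVneq i k; last first.
    by move/MP: yM => /(_ i ik); rewrite ltnNge le_y.
  rewrite -ik ltn_neqAle le_y // andbT; apply/eqP => /rk_inj yfi.
  by have := MS _ _ kK yM; rewrite yfi fS.
have Me k : k \in K -> e k \in M k.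
  move=> kK; apply/MP => i ik; apply: (leq_ltn_trans (fle i v0 v0S)).
  by apply: e_high => //; rewrite eq_sym.
pose top k := [arg max_(y > e k in M k) rk k y].
have topP k : k \in K ->
    top k \in M k /\ forall y, y \in M k -> rk k y <= rk k (top k).
  by move=> kK; rewrite /top; case: arg_maxnP => [|y]; [exact: Me|].
have -> : [set v | (v \notin S) && dominant (v |: S)] = top @: K.
  apply/setP => v; rewrite inE; apply/andP/imsetP => [[vS vdom]|[k kK ->]].
    have vv : v \in v |: S by rewrite !inE eqxx.
    pose g := lowest v (v |: S).
    have gS i : g i \in v |: S by case: (lowestP i vv).
    have gle i x : x \in v |: S -> rk i (g i) <= rk i x.
      by case: (lowestP i vv) => _; apply.
    have gimg : g @: [set: I] = v |: S by exact: lowest_imset.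
    have ginj : injective g.
      have /imset_injP inj : #|g @: [set: I]| == #|[set: I]|.
        by rewrite gimg cardsU1 vS cardsT cardI.
      by move=> i l; apply: inj; rewrite inE.
    have /imsetP[k _ vg] : v \in g @: [set: I] by rewrite gimg.
    have gf i : i != k -> g i = f i.
      move=> ik; have gi : g i \in S.
        have := gS i; rewrite !inE => /predU1P[giv|//].
        by case/eqP: ik; apply: ginj; rewrite giv.
      apply: (@rk_inj i); apply/eqP; rewrite eqn_leq fle // andbT gle //.
      by rewrite inE fS orbT.
    have kK : k \in K.
      rewrite !inE /= fimg; apply/eqP/setP => x.
      apply/imsetP/idP => [[i _ ->//]|xS].
      have /imsetP[i _ xg] : x \in g @: [set: I] by rewrite gimg inE xS orbT.
      have ik : i != k.
        by apply/negP => /eqP ik; move: vS; rewrite vg -ik -xg xS.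
      by exists i; rewrite ?inE ?ik // xg gf.
    have vM : v \in M k.
      apply/MP => i ik; rewrite -gf // ltn_neqAle gle // andbT.
      apply/eqP => /rk_inj giv; case/eqP: ik; apply: ginj.
      by rewrite -vg.
    exists k => //; apply: (@rk_inj k); apply/eqP; rewrite eqn_leq.
    have [topM le_top] := topP _ kK; rewrite le_top //=.
    have /dominantP/(_ (top k))[i le_i] := vdom.
    have [ik|ik] := eqVneq i k; first by move: (le_i v vv); rewrite ik.
    move/MP: topM => /(_ i ik); rewrite ltnNge le_i //.
    by rewrite inE fS orbT.
  have [topM le_top] := topP _ kK; split; first exact: MS topM.
  apply/dominantP => y; have [yM|] := boolP (y \in M k).
    exists k => x; case/setU1P => [->|xS]; first exact: le_top.
    exact: (leq_trans (ltnW (Mk _ _ kK yM)) (fle _ _ xS)).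
  rewrite inE negb_forall => /existsP[i].
  rewrite negb_imply -leqNgt => /andP[ik le_y].
  exists i => x; case/setU1P => [->|xS]; last exact: leq_trans (fle _ _ xS).
  by move/MP: topM => /(_ i ik) /ltnW; apply: leq_trans.
rewrite card_in_imset // => k l kK lK tkl; apply/eqP/negPn/negP => kl.
have /dominantP/(_ (top k))[i le_i] := Sdom.
have [tk _] := topP k kK; have [tl _] := topP l lK; rewrite -tkl in tl.
have [ik|ik] := eqVneq i k.
  by move/MP: tl => /(_ i); rewrite ltnNge le_i // ik => /(_ kl).
by move/MP: tk => /(_ i ik); rewrite ltnNge le_i.
Qed.

Variable c : V -> I.
Hypothesis c_slack : forall i, c (e i) = i.

(** A door is coloured if its colours are all the indices but i0. Count the
    pairs of a coloured door and a room that contains it. If no room had all the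
    colours, then a room would contain no coloured door or exactly two
    ([card_redundant]), so that the number of pairs would be even. But every
    coloured door lies in two rooms ([card_fill]) or is not dominant and lies in
    none, with one exception: the door that consists of all slacks but [e i0]
    lies in a single room, the one obtained by adding the greatest ordinary
    element in the order i0. *)
Theorem scarf (v0 : V) : v0 \notin codom e ->
  exists2 S : {set V}, dominant S & c @: S = [set: I].
Proof.
move=> v0e.
pose i0 := c v0.
suff /existsP[S /andP[Sdom /eqP cS]] :
    [exists S : {set V}, dominant S && (c @: S == [set: I])] by exists S.
apply: contraT; rewrite negb_exists => /forallP rainbow.
have norainbow S : dominant S -> c @: S != [set: I].
  by move=> Sdom; have := rainbow S; rewrite Sdom.
pose room (S : {set V}) := (#|S| == #|I|) && dominant S.
pose door (S : {set V}) := (#|S|.+1 == #|I|) && (c @: S == [set~ i0]).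
pose adj (S' S : {set V}) := [exists v, (v \notin S') && (S == v |: S')].
have cardsC1I : #|[set~ i0]|.+1 = #|I|.
  by rewrite -(cardsC [set i0]) cards1 add1n.
have room_even S : room S -> ~~ odd (\sum_(S' | door S') (adj S' S : nat)).
  move=> /andP[/eqP cardS Sdom].
  rewrite -big_mkcondr /= sum1_card.
  have -> : #|[pred S' | door S' & adj S' S]| =
            #|[set s in S | c @: (S :\ s) == [set~ i0]]|.
    rewrite -(@card_in_imset _ _ (fun s => S :\ s)); last first.
      move=> s t; rewrite !inE => /andP[sS _] /andP[tS _] st.
      apply/eqP/negPn/negP => neq_st.
      by have := setD11 s S; rewrite st !inE neq_st sS.
    apply: eq_card => S'; rewrite !inE; apply/andP/imsetP.
      move=> [/andP[_ cS']] /existsP[s /andP[sS' /eqP ->]].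
      have Ss : (s |: S') :\ s = S' by rewrite finset.setU1K.
      by exists s; rewrite ?inE ?eqxx ?Ss.
    move=> [s]; rewrite inE => /andP[sS cS] ->; split.
      by rewrite /door cS andbT -cardS (cardsD1 s S) sS.
    by apply/existsP; exists s; rewrite !inE eqxx /= finset.setD1K.
  have [cS|cS] := eqVneq (c @: S) [set~ i0].
    have := @card_redundant _ _ c S; rewrite cS => -> //.
    by rewrite cardS cardsC1I.
  rewrite (_ : [set _ in _ | _] = finset.set0) ?cards0 //.
  apply/setP => s; rewrite !inE; apply/negP => /andP[sS /eqP cs].
  have := norainbow S Sdom; rewrite -(finset.setD1K sS) imsetU1 cs.
  have [->|csi] := eqVneq (c s) i0; first by rewrite finset.setUCr eqxx.
  move=> _; case/eqP: cS.
  rewrite -(finset.setD1K sS) imsetU1 cs; apply/finset.setUidPr.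
  by rewrite finset.sub1set !inE.
have door_rooms S' : \sum_(S | room S) (door S' && adj S' S : nat) =
    if door S' then #|[set v | (v \notin S') && dominant (v |: S')]| else 0.
  case: ifP => [/andP[/eqP cardS' cS']|_]; last by rewrite big1.
  rewrite /= -big_mkcondr sum1_card.
  rewrite -(@card_in_imset _ _ (fun s => s |: S')); last first.
    move=> s t; rewrite !inE => /andP[sS _] /andP[tS _] st.
    by have := setU11 s S'; rewrite st !inE (negPf sS) orbF => /eqP.
  apply: eq_card => S; rewrite unfold_in; apply/andP/imsetP.
    move=> [/andP[_ Sdom]] /existsP[v /andP[vS' /eqP Se]].
    by exists v; rewrite // inE vS' -Se.
  move=> [v]; rewrite inE => /andP[vS' vdom] ->; split.
    by rewrite /room vdom cardsU1 vS' add1n cardS' eqxx.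
  by apply/existsP; exists v; rewrite vS' eqxx.
have : ~~ odd (\sum_(S | room S) \sum_(S' | door S') (adj S' S : nat)).
  elim/big_ind: _ => // x y ex ey; by rewrite oddD (negPf ex) (negPf ey).
rewrite exchange_big /=.
pose S0 := e @: [set~ i0].
have einj := e_inj v0e.
have cS0 : c @: S0 = [set~ i0].
  rewrite -imset_comp -[RHS]imset_id; apply: eq_imset => i /=.
  exact: c_slack.
have cardS0 : #|S0|.+1 = #|I| by rewrite card_imset.
have doorS0 : door S0 by rewrite /door cS0 cardS0 !eqxx.
rewrite (bigD1 S0) //= oddD.
have other_even S' : door S' && (S' != S0) ->
    ~~ odd (\sum_(S | room S) (adj S' S : nat)).
  move=> /andP[dS' neqS]; have := door_rooms S'; rewrite dS' /= => ->.
  have [S'dom|S'ndom] := boolP (dominant S'); last first.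
    rewrite (_ : [set _ | _] = finset.set0) ?cards0 //.
    apply/setP => v; rewrite !inE; apply/negP => /andP[_].
    by move=> /(dominant_sub (finset.subsetUr _ _)); apply/negP.
  have [cardS' cS'] := andP dS'.
  have [/fintype.subsetP sub|/fintype.subsetPn[v1 v1S' v1e]] :=
    boolP (S' \subset codom e).
    case/eqP: neqS; apply/eqP; rewrite eqEcard.
    rewrite -ltnS (eqP cardS') cardS0 leqnn andbT.
    apply/fintype.subsetP => x xS'; have /codomP[i xi] := sub x xS'.
    rewrite xi; apply: imset_f.
    have : c x \in c @: S' by apply: imset_f.
    by rewrite (eqP cS') xi c_slack.
  by rewrite (card_fill v1S' v1e S'dom) // (eqP cardS').
have /negPf -> : ~~ odd (\sum_(S' | door S' && (S' != S0))
    \sum_(S | room S) (adj S' S : nat)).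
  by elim/big_ind: _ => // x y ex ey; rewrite oddD (negPf ex) (negPf ey).
have := door_rooms S0; rewrite doorS0 /= => ->.
pose top := [arg max_(y > v0 | y \notin codom e) rk i0 y].
have [tope le_top] : top \notin codom e /\
    forall y, y \notin codom e -> rk i0 y <= rk i0 top.
  by rewrite /top; case: arg_maxnP.
suff -> : [set v | (v \notin S0) && dominant (v |: S0)] = [set top].
  by rewrite cards1.
have eS0 j : j != i0 -> e j \in S0 by move=> ji; rewrite imset_f // !inE.
apply/setP => v; rewrite !inE; apply/andP/eqP => [[vS0 /dominantP vdom]|->].
  have ve : v \notin codom e.
    apply/negP => /codomP[j vj].
    have ji : j = i0 by apply/eqP; apply: contraR vS0; rewrite vj => /eS0.
    have [i le_i] := vdom v0.
    have eiS : e i \in v |: S0.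
      by rewrite inE vj ji inE (inj_eq einj); case: eqVneq => //= /eS0.
    have := le_i _ eiS; rewrite leqNgt ltn_neqAle e_low andbT.
    by case: eqP => // /rk_inj ei; case/negP: v0e; rewrite -ei codom_f.
  apply: (@rk_inj i0); apply/eqP; rewrite eqn_leq le_top //=.
  have [i le_i] := vdom top; have [ii0|ii0] := eqVneq i i0.
    by rewrite -ii0 le_i // !inE eqxx.
  have := le_i (e i); rewrite inE eS0 // orbT => /(_ isT).
  rewrite leqNgt ltn_neqAle e_low andbT.
  by case: eqP => // /rk_inj ei; case/negP: tope; rewrite -ei codom_f.
split.
  by apply/negP => /imsetP[j _ tj]; rewrite tj codom_f in tope.
apply/dominantP => y; have [/codomP[j ->]|ye] := boolP (y \in codom e).
  by exists j => x _; apply: e_low.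
exists i0 => x; case/setU1P => [->|/imsetP[j]]; first exact: le_top.
by rewrite !inE => ji ->; apply/ltnW/e_high.
Qed.
End Scarf.

(** Scarf's theorem for the integer points of the simplex of size N, with the
    coordinate i as the i-th order (ties are broken by an injective numbering of
    the grid). Dominance says that a grid point cannot exceed the lowest
    coordinates of the room by one in each order whose slack is absent, so these
    lowest coordinates add up to more than N - #|I|: the room has diameter at
    most #|I|, and coordinates whose slack belongs to the room are below #|I|.
    If the slack of i is absent, the colour i is taken at a grid point of the
    room. If it is present, the i-th coordinate of a point of the room can be
    transferred to another coordinate, which yields a close point on the i-th
    face. *)
Lemma scarf_grid (I : finType) (N : nat) (c : (I -> nat) -> I) :
  exists2 x : I -> nat, \sum_i x i = N &
    forall i, exists y : I -> nat, [/\ \sum_k y k = N, c y = i \/ y i = 0 &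
      forall k, x k <= y k + #|I| /\ y k <= x k + #|I|].
Proof.
pose T := {x : {ffun I -> 'I_N.+1} | \sum_i x i == N}.
have gridP (y : I -> nat) : \sum_i y i = N ->
    exists t : T, forall i, val t i = y i :> nat.
  move=> sumy.
  have yN i : y i < N.+1 by rewrite ltnS -sumy (bigD1 i) //= leq_addr.
  pose f := [ffun i => Ordinal (yN i)].
  have sumf : \sum_i f i == N.
    by rewrite -[X in _ == X]sumy; apply/eqP/eq_bigr => i _; rewrite ffunE.
  by exists (exist _ f sumf) => i; rewrite /= ffunE.
pose V : finType := (T + I)%type.
pose e (i : I) : V := inr i.
have [B [r [rB r_inj]]] : exists B (r : T -> nat),
    (forall x, r x < B) /\ injective r.
  exists #|{: T}|, (fun x => nat_of_ord (enum_rank x)).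
  by split=> [x|x y /ord_inj /enum_rank_inj //]; exact: ltn_ord.
pose rk i (v : V) : nat := match v with
  | inl x => (val x i * B + r x).+1
  | inr j => if j == i then 0 else (N.+1 * B + enum_rank j).+1
  end.
have rkT i (x : T) : rk i (inl x) <= N.+1 * B.
  by rewrite /rk mulSn addnC -addSn leq_add // leq_mul2r -ltnS ltn_ord orbT.
have rk_inj i : injective (rk i).
  have rkTI x j : rk i (inl x) != rk i (inr j).
    rewrite [X in _ != X]/=; case: ifP => // _.
    by rewrite neq_ltn (leq_ltn_trans (rkT i x)) // ltnS leq_addr.
  case=> [x|j] [y|k] eq_rk.
  - case: eq_rk => /(congr1 (modn^~ B)).
    by rewrite !modnMDl !modn_small // => /r_inj ->.
  - by have := rkTI x k; rewrite eq_rk eqxx.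
  - by have := rkTI y j; rewrite eq_rk eqxx.
  - move: eq_rk => /=; case: eqP => [->|_]; case: eqP => [->|_] //.
    by case=> /addnI /ord_inj /enum_rank_inj ->.
have rk_le i (x y : T) : rk i (inl y) <= rk i (inl x) -> val y i <= val x i.
  rewrite /= ltnS => le_rk; rewrite leqNgt; apply/negP => lt_xy.
  have := rB x; move: le_rk lt_xy; nia.
have e_low i y : rk i (e i) <= rk i y by rewrite /= eqxx.
have e_high i j y : j != i -> y \notin codom e -> rk i y < rk i (e j).
  case: y => [x /negPf|k _ /negP[]]; last exact: codom_f.
  by rewrite /= => -> _; rewrite ltnS (leq_trans (rkT i x)) // leq_addr.
pose col (v : V) := match v with
  | inl x => c (fun i => val x i) | inr i => i end.
have [t0 _] : exists t : T, forall i,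
    val t i = (if i == c (fun=> 0) then N else 0) :> nat.
  by apply: gridP; rewrite -big_mkcond big_pred1_eq.
have t0e : (inl t0 : V) \notin codom e by apply/negP => /codomP[].
have [S /dominantP Sdom Scol] :=
  scarf rk_inj e_low e_high (c := col) (fun=> erefl) t0e.
(* D is the set of indices whose slack is missing from the room *)
pose D := [set i | e i \notin S].
have colorD i : i \in D -> exists2 x, inl x \in S & col (inl x) = i.
  rewrite inE => iS; have : i \in col @: S by rewrite Scol.
  by case/imsetP => -[x|k] vS vi; [exists x | case/negP: iS; rewrite vi].
have gridD (t : T) :
    exists2 i, i \in D & forall x : T, inl x \in S -> val t i <= val x i.
  have [i le_i] := Sdom (inl t); exists i => [|x xS]; last exact/rk_le/le_i.
  by rewrite inE; apply/negP => /le_i; rewrite /= eqxx.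
have [d0 d0D _] := gridD t0; have [x0 x0S _] := colorD d0 d0D.
pose low i := [arg min_(x < x0 | inl x \in S) nat_of_ord (val x i)].
pose m i : nat := val (low i) i.
have m_le i x : inl x \in S -> m i <= val x i.
  by rewrite /m /low; case: arg_minnP => // y _; apply.
have lowS i : inl (low i) \in S by rewrite /low; case: arg_minnP.
have sum_m : N < \sum_(i in D) (m i).+1.
  rewrite ltnNge; apply/negP => sum_le.
  (* this grid point would beat the lowest elements in every order of D; the
     index d0 receives the remaining mass *)
  pose y i := if i \in D then
    if i == d0 then (m i).+1 + (N - \sum_(k in D) (m k).+1) else (m i).+1
    else 0.
  have [t ty] : exists t : T, forall i, val t i = y i :> nat.
    apply: gridP; rewrite /y -big_mkcond (bigD1 d0) //= eqxx.
    rewrite [X in _ + X](eq_bigr (fun i => (m i).+1)); last first.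
      by move=> i /andP[_ /negPf ->].
    move: sum_le; rewrite (bigD1 d0) //=; lia.
  have [i iD le_i] := gridD t; have := le_i _ (lowS i).
  by rewrite ty -/(m i) /y iD; case: ifP; lia.
have sumD x : inl x \in S ->
    \sum_(i in D) (val x i - m i) + \sum_(i | i \notin D) val x i < #|I|.
  move=> xS; have := eqP (valP x); rewrite (bigID (mem D)) /= => sumx.
  have : \sum_(i in D) val x i =
      \sum_(i in D) (val x i - m i) + \sum_(i in D) m i.
    by rewrite -big_split; apply: eq_bigr => i _; rewrite /= subnK // m_le.
  move: sum_m => /=; under eq_bigr do rewrite -addn1.
  rewrite big_split /= sum1_card => ltN sumxD.
  rewrite -(ltn_add2r (\sum_(i in D) m i)) addnAC -sumxD sumx.
  by rewrite (leq_trans ltN) // addnC leq_add2r max_card.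
have diffD i x : i \in D -> inl x \in S -> val x i < m i + #|I|.
  move=> iD /[dup] xS /sumD; rewrite (bigD1 i) //=.
  have := m_le i x xS; lia.
have smallC i x : i \notin D -> inl x \in S -> val x i < #|I|.
  by move=> iD /sumD; rewrite addnC (bigD1 i) //=; lia.
have close i x y : inl x \in S -> inl y \in S -> val x i <= val y i + #|I|.
  move=> xS yS; have [iD|iD] := boolP (i \in D).
    by have := diffD i x iD xS; have := m_le i y yS; lia.
  by have := smallC i x iD xS; lia.
exists (fun i => val x0 i : nat); first exact/eqP/(valP x0).
move=> i; have [iD|iD] := boolP (i \in D).
  have [y yS yi] := colorD i iD; exists (fun k => val y k : nat).
  by split; [exact/eqP/(valP y) | left | move=> k; rewrite !close].
have id0 : i != d0 by apply: contraNneq iD => ->.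
pose y k := if k == i then 0 else
  if k == d0 then val x0 d0 + val x0 i else val x0 k.
exists y; split.
- have := eqP (valP x0); rewrite (bigD1 i) // (bigD1 d0) 1?eq_sym //= => <-.
  rewrite (bigD1 i) // (bigD1 d0) 1?eq_sym //= /y eqxx eq_sym (negPf id0) eqxx.
  rewrite (eq_bigr (fun k => val x0 k : nat)); first by rewrite /=; lia.
  by move=> k /andP[/negPf -> /negPf ->].
- by right; rewrite /y eqxx.
- move=> k; rewrite /y; have := smallC i x0 iD x0S.
  by case: eqP => [->|_]; [lia | case: eqP => [->|_]; lia].
Qed.

(** * The dual Knaster-Kuratowski-Mazurkiewicz theorem *)

Local Open Scope classical_set_scope.
Local Open Scope ring_scope.

Definition simplex (R : realType) (n : nat) : set 'rV[R]_n :=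
  [set x | (forall i, 0 <= x 0 i) /\ \sum_i x 0 i = 1].

Lemma continuous_sum (R : realType) (U : topologicalType) (I : finType)
    (f : I -> U -> R) :
  (forall i, continuous (f i)) -> continuous (fun x => \sum_i f i x).
Proof.
move=> fcts.
exact: (@continuous_big R I +%R 0 xpredT (@add_continuous R) U (index_enum I) f).
Qed.

Lemma simplex_compact (R : realType) (n : nat) : compact (@simplex R n).
Proof.
apply: (@subclosed_compact _ _
    [set x : 'rV[R]_n | forall i, `[0, 1]%classic (x 0 i)]).
- rewrite (_ : @simplex R n =
    (\bigcap_(i in [set: 'I_n]) [set x | 0 <= x 0 i]) `&`
    [set x | \sum_i x 0 i = 1]); last first.
    by apply/seteqP; split=> x [x0 x1]; split=> // i; [move=> _|]; exact: x0.
  apply: closedI; last first.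
    apply: (preimage_closed _ (@closed_eq R 1)).
    by move=> x _; apply: continuous_sum => i; exact: coord_continuous.
  apply: closed_bigI => i _.
  apply: (preimage_closed _ (@closed_ge R 0)) => x _.
  exact: coord_continuous.
- exact: (@rV_compact R n (fun=> `[0, 1]%classic) (fun=> @segment_compact R 0 1)).
move=> x [x0 x1] i /=; rewrite in_itv /= x0 /= -x1 (bigD1 i) //=.
by rewrite lerDl sumr_ge0.
Qed.

(** Colour a grid point x by some i with x in F_i. [scarf_grid] gives a point
    that is within (n+1)/(N+1) of every F_i, thanks to the faces in the case of
    slacks; a cluster point as N grows lies in all the F_i because these are
    closed. *)
Theorem dual_KKM (R : realType) (n : nat) (F : 'I_n.+1 -> set 'rV[R]_n.+1) :
  (forall i, closed (F i)) ->
  (forall x, simplex x -> exists i, F i x) ->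
  (forall x i, simplex x -> x 0 i = 0 -> F i x) ->
  exists2 x, simplex x & forall i, F i x.
Proof.
move=> Fclosed Fcover Fface.
pose pt N (y : 'I_n.+1 -> nat) : 'rV[R]_n.+1 := \row_i ((y i)%:R / N.+1%:R).
have pt_simplex N y : (\sum_i y i)%N = N.+1 -> simplex (pt N y).
  move=> sumy; split=> [i|]; first by rewrite mxE divr_ge0.
  under eq_bigr do rewrite mxE.
  by rewrite -mulr_suml -natr_sum sumy divff.
have approx N : exists2 x, simplex x & forall i, exists y,
    [/\ simplex y, F i y & `|x - y| <= n.+1%:R / N.+1%:R].
  pose c y := xget ord0 [set i | F i (pt N y)].
  have [x sumx close] := scarf_grid N.+1 c.
  exists (pt N x); first exact: pt_simplex.
  move=> i; have [y [sumy yi xy]] := close i; exists (pt N y).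
  have ysimplex := pt_simplex _ _ sumy; split=> //.
    case: yi => [<-|yi0]; last by apply: Fface; rewrite // mxE yi0 mul0r.
    by have [k Fk] := Fcover _ ysimplex; rewrite /c; case: xgetP => [?|/(_ k)].
  rewrite [leLHS]/Num.norm /= mx_normrE; apply/bigmax_leP.
  split=> [|[a k] _ /=]; first by rewrite divr_ge0.
  have N0 : 0 <= N.+1%:R^-1 :> R by rewrite invr_ge0.
  rewrite !mxE -mulrBl normrM (ger0_norm N0) ler_wpM2r //.
  have [] := xy k; rewrite card_ord -!(ler_nat R) !natrD => h1 h2.
  by rewrite ler_norml; lra.
have [|X XP] := @boolp.choice _ _ (fun N x => simplex x /\ forall i, exists y,
    [/\ simplex y, F i y & `|x - y| <= n.+1%:R / N.+1%:R]).
  by move=> N; have [x xs xF] := approx N; exists x.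
have [|x [xs xcluster]] := @simplex_compact R n.+1 (X @ \oo) _.
  by apply: (@nearW _ \oo) => N; case: (XP N).
exists x => // i.
rewrite ((closure_id _).1 (Fclosed i)) => B /nbhs_ballP[e /= e0 xB].
pose r := n.+1%:R / (e / 2).
have [||y []] := xcluster (X @` [set N | r < N.+1%:R]) (ball x (e / 2)).
- apply: (@filterS _ \oo _ [set N | r < N.+1%:R]) => [N|]; first by exists N.
  near=> N.
  rewrite /= (@lt_le_trans _ _ N%:R) ?ler_nat //; near: N; exact: nbhs_infty_gtr.
- by apply: nbhsx_ballx; rewrite divr_gt0.
move=> [N /= rN <-] xX; have [_ /(_ i)[z [_ Fz zX]]] := XP N.
exists z; split=> //; apply: xB.
rewrite -ball_normE /= in xX *.
rewrite (splitr e) -[x](subrK (X N)) -addrA (le_lt_trans (ler_normD _ _)) //.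
rewrite ltrD // (le_lt_trans zX) // ltr_pdivrMr // mulrC.
by rewrite -ltr_pdivrMr ?divr_gt0.
Unshelve. all: by end_near.
Qed.

(** * Convex combinations and Ky Fan's inequality *)

Lemma convex_setP (R : realType) (E : lmodType R) (A : set E) :
  convex_set (A : set (convex_lmodType E)) <->
  forall (t : R) x y, 0 <= t <= 1 -> A x -> A y -> A (t *: x + (1 - t) *: y).
Proof.
split=> [Acvx t x y t01 Ax Ay|Acvx x y t /set_mem Ax /set_mem Ay].
  have tI : Itv.spec (@Itv.num_sem R) (Itv.Real `[0%Z, 1%Z]) t.
    by rewrite /= /Itv.num_sem /= in_itv /= t01 andbT ger0_real; case/andP: t01.
  have := Acvx x y (Itv.mk tI).
  by rewrite !inE => /(_ Ax Ay).
apply/mem_set; apply: Acvx => //.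
by apply/andP; split.
Qed.

(** Membership of y i is asked only for indices of positive weight, so that
    [ky_fan_finite] can apply the lemma to the set of the y with phi x y > 0,
    which contains only some of the test points. *)
Lemma convex_set_sum (R : realType) (E : lmodType R) (A : set E)
    (I : finType) (t : I -> R) (y : I -> E) :
  convex_set (A : set (convex_lmodType E)) ->
  (forall i, 0 <= t i) -> \sum_i t i = 1 -> (forall i, 0 < t i -> A (y i)) ->
  A (\sum_i t i *: y i).
Proof.
move=> /convex_setP Acvx t0 t1 Ay.
(* normalizing the partial sums turns the claim into an induction on s *)
suff scaled (s : seq I) : 0 < \sum_(i <- s) t i ->
    A ((\sum_(i <- s) t i)^-1 *: \sum_(i <- s) t i *: y i).
  by have := scaled (index_enum I); rewrite t1 invr1 scale1r; apply.
elim: s => [|i s IHs]; first by rewrite big_nil ltxx.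
rewrite !big_cons; set T := \sum_(k <- s) t k; set Y := \sum_(k <- s) _.
have T0 : 0 <= T by exact: sumr_ge0.
have [->|ti_neq0] := eqVneq (t i) 0.
  by rewrite !add0r scale0r add0r; exact: IHs.
have ti0 : 0 < t i by rewrite lt_neqAle eq_sym ti_neq0 t0.
have [TE _|T_neq0 _] := eqVneq T 0.
  have -> : Y = 0.
    rewrite /Y big_seq big1 // => k ks; apply/eqP; rewrite scaler_eq0.
    move/eqP: TE; rewrite /T psumr_eq0 // => /allP /(_ k ks) /= ->.
    by [].
  by rewrite TE !addr0 scalerA mulVf // scale1r; exact: Ay.
have {}T0 : 0 < T by rewrite lt_neqAle eq_sym T_neq0.
have sum0 : 0 < t i + T by rewrite addr_gt0.
have -> : (t i + T)^-1 *: (t i *: y i + Y) =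
    (t i / (t i + T)) *: y i + (1 - t i / (t i + T)) *: (T^-1 *: Y).
  rewrite scalerDr !scalerA; congr (_ *: _ + _ *: _); first exact: mulrC.
  by field; rewrite !gt_eqF.
apply: Acvx; [|exact: Ay|exact: IHs].
apply/andP; split; first by rewrite divr_ge0 // ltW.
by rewrite ler_pdivrMr // mul1r lerDl ltW.
Qed.

(** Let b(t) be the combination of the y_i with weights t and let
    g_i(t) = max(phi(b(t), y_i), 0). The sets g_i >= t_i * sum_k g_k satisfy the
    hypotheses of [dual_KKM], and at a common point equality holds throughout,
    as both sides have the same sum: g is proportional to t. Were the factor
    positive, phi(b(t), y_i) would be positive whenever t_i is, hence
    phi(b(t), b(t)) > 0 by quasi-concavity. *)
Lemma ky_fan_finite (R : realType) (E : normedModType R) (K : set E)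
    (phi : E -> E -> R) (n : nat) (y : 'I_n.+1 -> E) :
  convex_set (K : set (convex_lmodType E)) ->
  (forall y, K y -> continuous (phi^~ y)) ->
  (forall x, K x -> convex_set ([set y | K y /\ 0 < phi x y]
    : set (convex_lmodType E))) ->
  (forall x, K x -> phi x x <= 0) ->
  (forall i, K (y i)) ->
  exists2 x, K x & forall i, phi x (y i) <= 0.
Proof.
move=> Kcvx phi_cts phi_cvx phi_diag Ky.
pose b (t : 'rV[R]_n.+1) : E := \sum_i t 0 i *: y i.
have bK t : simplex t -> K (b t).
  by move=> [t0 t1]; apply: convex_set_sum => // i _; exact: Ky.
have b_cts : continuous b.
  apply: (@continuous_big E 'I_n.+1 +%R 0 xpredT (@add_continuous E)
    _ _ (fun i (t : 'rV[R]_n.+1) => t 0 i *: y i)) => i _ t.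
  by apply: continuousZr_tmp; exact: coord_continuous.
pose g i (t : 'rV[R]_n.+1) : R := Num.max (phi (b t) (y i)) 0.
have g0 i t : 0 <= g i t by rewrite le_max lexx orbT.
have g_cts i : continuous (g i).
  move=> t; apply: (@continuous_max R _ (fun t => phi (b t) (y i)) (fun=> 0)).
    apply: (@continuous_comp _ _ _ b (phi^~ (y i))); first exact: b_cts.
    exact: phi_cts.
  exact: cst_continuous.
pose F i := [set t : 'rV[R]_n.+1 | 0 <= g i t - t 0 i * \sum_k g k t].
have [|||t st Ft] := @dual_KKM R n F.
- move=> i; apply: (preimage_closed _ (@closed_ge R 0)) => t _.
  apply: (@continuousB R R^o _ (g i) (fun t => t 0 i * \sum_k g k t)).
    exact: g_cts.
  apply: (@continuousM R _ (fun t : 'rV[R]_n.+1 => t 0 i)).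
    exact: coord_continuous.
  exact: continuous_sum.
- move=> t [t0 t1]; apply/not_existsP => notF.
  have lt_g i : g i t < t 0 i * \sum_k g k t.
    by have /negP := notF i; rewrite /F /= subr_ge0 -ltNge.
  have : \sum_i g i t < \sum_i (t 0 i * \sum_k g k t).
    by apply: ltr_sum => //; apply/hasP; exists ord0 => //; exact: mem_index_enum.
  by rewrite -mulr_suml t1 mul1r ltxx.
- by move=> t i st t0; rewrite /F /= t0 mul0r subr0 g0.
exists (b t); first exact: bK.
have [t0 t1] := st.
set S := \sum_k g k t in Ft.
have gE i : g i t = t 0 i * S.
  apply/eqP; rewrite -subr_eq0; apply/eqP.
  apply: (@psumr_eq0P _ _ xpredT (fun i => g i t - t 0 i * S)) => // [k _|].
    exact: Ft.
  by rewrite sumrB -mulr_suml t1 mul1r subrr.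
have S0 : S = 0.
  apply/eqP; rewrite eq_le sumr_ge0 // andbT leNgt; apply/negP => S_gt0.
  have Kbt := bK t st.
  have [_] : [set y | K y /\ 0 < phi (b t) y] (b t).
    apply: convex_set_sum => //; first exact: phi_cvx.
    move=> i ti0; split=> //; have := mulr_gt0 ti0 S_gt0.
    by rewrite -gE lt_max ltxx orbF.
  by rewrite ltNge phi_diag.
by move=> i; have := gE i; rewrite S0 mulr0 => <-; rewrite le_max lexx.
Qed.

(** The sets of the x with phi x y <= 0 are closed in a compact set, and any
    finitely many of them meet by [ky_fan_finite]. *)
Theorem ky_fan (R : realType) (E : normedModType R) (K : set E)
    (phi : E -> E -> R) :
  compact K -> K !=set0 -> convex_set (K : set (convex_lmodType E)) ->
  (forall y, K y -> continuous (phi^~ y)) ->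
  (forall x, K x -> convex_set ([set y | K y /\ 0 < phi x y]
    : set (convex_lmodType E))) ->
  (forall x, K x -> phi x x <= 0) ->
  exists2 x, K x & forall y, K y -> phi x y <= 0.
Proof.
move=> Kco [y0 Ky0] Kcvx phi_cts phi_cvx phi_diag.
pose f y := K `&` [set x | phi x y <= 0].
move: Kco; rewrite compact_In0 => /(_ E K f)[||x xf].
- exists (fun y => [set x | phi x y <= 0]) => // y Ky.
  by apply: (preimage_closed _ (@closed_le R 0)) => x _; exact: phi_cts.
- move=> D DK; pose s : seq E := finmap.enum_fset D.
  (* y0 is put in front because there may be no test point *)
  pose z (i : 'I_(size s).+1) := nth y0 (y0 :: s) i.
  have zK i : K (z i).
    rewrite /z; case: i => -[|i] //= iD.
    by apply/set_mem/DK; rewrite mem_nth.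
  have [x Kx xz] := ky_fan_finite Kcvx phi_cts phi_cvx phi_diag zK.
  exists x => y /= yD; split=> //=.
  have := xz (lift ord0 (Ordinal (_ : index y s < size s)%N)).
  by rewrite /z /= nth_index // index_mem; apply.
by exists x => [|y Ky]; [case: (xf y0 Ky0) | case: (xf y Ky)].
Qed.

(** * Properties of the risk-adjusted value *)

Section RiskValue.
Variables (R : realType) (Omega : finType) (Q : set (Omega -> R)).
Hypothesis Q0 : Q !=set0.
Hypothesis Q_closed : closed (Q : set {ptws Omega -> R}).
Hypothesis Q_prob : Q `<=` @prob_measures R Omega.

Lemma risk_value_le_expect mu Z : Q mu -> risk_value Q Z <= expect mu Z.
Proof.
move=> Qmu; have [nu _ [-> min_nu]] := risk_value_min Z Q0 Q_closed Q_prob.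
exact: min_nu.
Qed.

Lemma le_risk_value Z Z' : (forall w, Z w <= Z' w) ->
  risk_value Q Z <= risk_value Q Z'.
Proof.
move=> ZZ'; have [mu Qmu [-> _]] := risk_value_min Z' Q0 Q_closed Q_prob.
apply: le_trans (risk_value_le_expect Z Qmu) _.
by apply: ler_sum => w _; rewrite ler_wpM2l //; case: (Q_prob Qmu).
Qed.

(** The worst measure for the mixture is admissible for both terms. *)
Lemma risk_value_concave t Z Z' : 0 <= t <= 1 ->
  t * risk_value Q Z + (1 - t) * risk_value Q Z' <=
  risk_value Q (fun w => t * Z w + (1 - t) * Z' w).
Proof.
move=> /andP[t0 t1].
have [mu Qmu [-> _]] := risk_value_min (fun w => t * Z w + (1 - t) * Z' w)
  Q0 Q_closed Q_prob.
have -> : expect mu (fun w => t * Z w + (1 - t) * Z' w) =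
    t * expect mu Z + (1 - t) * expect mu Z'.
  by rewrite /expect !mulr_sumr -big_split; apply: eq_bigr => w _ /=; ring.
by rewrite lerD // ler_wpM2l ?subr_ge0 // risk_value_le_expect.
Qed.

Lemma risk_value_lipschitz Z Z' :
  risk_value Q Z <= risk_value Q Z' + \sum_w `|Z w - Z' w|.
Proof.
have [mu Qmu [-> _]] := risk_value_min Z' Q0 Q_closed Q_prob.
apply: le_trans (risk_value_le_expect Z Qmu) _.
rewrite -big_split; apply: ler_sum => w _ /=.
have [mu0 mu1] := Q_prob Qmu.
have mu_le1 : mu w <= 1.
  by rewrite -mu1 (bigD1 w) //= lerDl sumr_ge0.
rewrite -lerBlDl -mulrBr (le_trans (ler_norm _)) // normrM ger0_norm //.
by rewrite ler_piMl.
Qed.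

Lemma risk_value_continuous (U : topologicalType) (Z : U -> Omega -> R) :
  (forall w, continuous (Z^~ w)) -> continuous (fun u => risk_value Q (Z u)).
Proof.
move=> Zcts u; apply/cvgrPdist_lt => e e0.
have Scts : continuous (fun v => \sum_w `|Z v w - Z u w|).
  apply: continuous_sum => w v; apply: cvg_norm.
  by apply: cvgB; [exact: Zcts|exact: cvg_cst].
have /cvgrPdist_lt/(_ e e0) := Scts u.
apply: filterS => v.
rewrite [X in `|X - _|]big1 ?sub0r ?normrN => [Se|w _]; last first.
  by rewrite subrr normr0.
apply: le_lt_trans Se; rewrite [leRHS]ger0_norm ?sumr_ge0 //.
have := risk_value_lipschitz (Z u) (Z v); have := risk_value_lipschitz (Z v) (Z u).
under [in X in _ -> X -> _]eq_bigr do rewrite distrC.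
by rewrite ler_norml => ? ?; apply/andP; split; lra.
Qed.
End RiskValue.

(** * Plans of a generator reduced to setpoint and dispatch *)

Section Generator.
Variables (R : realType) (Omega : finType) (c ru rv : R) (G : Omega -> R).
Hypotheses (ru0 : 0 <= ru) (rv0 : 0 <= rv) (G0 : forall w, 0 <= G w).

(** A schedule s gives the setpoint [s None] and the dispatch [s (Some w)]; the
    deviations are the cheapest ones that balance them. *)
Definition plan_of (s : option Omega -> R) : plan R Omega :=
  Plan (s None) (fun w => s (Some w))
    (fun w => Num.max (s (Some w) - s None) 0)
    (fun w => Num.max (s None - s (Some w)) 0).

(** The cap on the setpoint, harmless because it is at least every capacity,
    makes this set compact. *)
Definition schedules : set (option Omega -> R) :=
  [set s | 0 <= s None <= \sum_w G w /\ forall w, 0 <= s (Some w) <= G w].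

Lemma plan_of_feasible s : schedules s -> feasible_plan G (plan_of s).
Proof.
move=> [/andP[s0 _] sG]; split=> // w; split=> //=; last 2 first.
- by rewrite le_max lexx orbT.
- by rewrite le_max lexx orbT.
by rewrite /Num.max; do 2 case: ifP; lra.
Qed.

(** A setpoint above all capacities only costs downward deviation, and for given
    setpoint and dispatch the positive and negative parts are the least
    deviations. *)
Lemma plan_of_dominates price p : feasible_plan G p ->
  exists2 s, schedules s & forall w,
    profit c ru rv price p w <= profit c ru rv price (plan_of s) w.
Proof.
move=> [x0 feas]; pose M := \sum_w G w.
have GM w : G w <= M by rewrite /M (bigD1 w) //= lerDl sumr_ge0.
exists (fun o => if o is Some w then dispatch p w else Num.min (setpoint p) M).
  split=> [|w]; last by case: (feas w).
  by rewrite le_min x0 sumr_ge0 //= ge_min lexx orbT.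
move=> w; have [bal /andP[X0 XG] U0 V0] := feas w; have := GM w.
rewrite /profit /= => GwM; rewrite -!addrA lerD2l -!opprD lerN2.
by apply: lerD; apply: ler_wpM2l => //; rewrite /Num.max /Num.min;
  do 2 case: ifP; lra.
Qed.

Lemma max0_convex (t x y : R) : 0 <= t <= 1 ->
  Num.max (t * x + (1 - t) * y) 0 <= t * Num.max x 0 + (1 - t) * Num.max y 0.
Proof.
move=> /andP[t0 t1]; have t1' : 0 <= 1 - t by rewrite subr_ge0.
rewrite ge_max; apply/andP; split.
  by rewrite lerD // ler_wpM2l // le_max lexx.
by rewrite addr_ge0 // mulr_ge0 // le_max lexx orbT.
Qed.

Lemma profit_concave price (t : R) s s' w : 0 <= t <= 1 ->
  t * profit c ru rv price (plan_of s) w +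
  (1 - t) * profit c ru rv price (plan_of s') w <=
  profit c ru rv price (plan_of (fun o => t * s o + (1 - t) * s' o)) w.
Proof.
move=> t01; rewrite /profit /=.
set x := s (Some w); set y := s None; set x' := s' (Some w); set y' := s' None.
have hu := max0_convex (x - y) (x' - y') t01.
have hv := max0_convex (y - x) (y' - x') t01.
rewrite (_ : t * x + (1 - t) * x' - (t * y + (1 - t) * y') =
  t * (x - y) + (1 - t) * (x' - y')); last by ring.
rewrite (_ : t * y + (1 - t) * y' - (t * x + (1 - t) * x') =
  t * (y - x) + (1 - t) * (y' - x')); last by ring.
have := ler_wpM2l ru0 hu; have := ler_wpM2l rv0 hv.
move: (Num.max _ _) (Num.max _ _) (Num.max _ _) => A B C.
move: (Num.max _ _) (Num.max _ _) (Num.max _ _) => A' B' C'.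
lra.
Qed.

Lemma schedules_convex (t : R) s s' : 0 <= t <= 1 ->
  schedules s -> schedules s' ->
  schedules (fun o => t * s o + (1 - t) * s' o).
Proof.
move=> t01.
have itv (x y M : R) : 0 <= x <= M -> 0 <= y <= M ->
    0 <= t * x + (1 - t) * y <= M.
  by move: t01 => /andP[? ?] /andP[? ?] /andP[? ?]; apply/andP; split; nra.
by move=> [n sG] [n' s'G]; split=> [|w]; exact: itv.
Qed.

Lemma profit_continuous (U : topologicalType) (price : U -> Omega -> R)
    (s : U -> option Omega -> R) (w : Omega) :
  continuous (price^~ w) -> (forall o, continuous (s^~ o)) ->
  continuous (fun u => profit c ru rv (price u) (plan_of (s u)) w).
Proof.
move=> pcts scts u; rewrite /profit /=.
have max_cts (f : U -> R) : continuous f ->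
    {for u, continuous (fun v => Num.max (f v) 0)}.
  move=> fcts; apply: (@continuous_max R _ f (fun=> 0)); first exact: fcts.
  exact: cst_continuous.
apply: cvgB; first apply: cvgB.
- apply: cvgM; last exact: scts.
  by apply: cvgB; [exact: pcts|exact: cvg_cst].
- apply: cvgM; first exact: cvg_cst.
  by apply: max_cts => v; apply: cvgB; exact: scts.
- apply: cvgM; first exact: cvg_cst.
  by apply: max_cts => v; apply: cvgB; exact: scts.
Qed.
End Generator.

(** * The Nikaido-Isoda function of the market *)

Section Market.
Variables (R : realType) (Omega Node Gen : finType).
Variables (j : Gen -> Node) (m : nat).
Variables (flows : set 'rV[R]_m) (tau : Node -> {linear 'rV[R]_m -> R^o}).
Variables (c ru rv : Gen -> R) (G : Gen -> Omega -> R) (D : Node -> Omega -> R).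
Variables (Q : Gen -> set (Omega -> R)) (VOLL : R).

(** A profile of all the agents is a single real function on this finite type,
    so that it lives in one finite-dimensional space: flows by scenario and
    component, prices by node and scenario, schedules by generator. *)
Definition coordinate : finType :=
  ((Omega * 'I_m) + (Node * Omega) + (Gen * option Omega))%type.

Implicit Types a b : coordinate -> R.

Definition flow a (w : Omega) : 'rV[R]_m := \row_k a (inl (inl (w, k))).
Definition price a (n : Node) (w : Omega) : R := a (inl (inr (n, w))).
Definition schedule a (i : Gen) (o : option Omega) : R := a (inr (i, o)).

Definition assemble (F : Omega -> 'rV[R]_m) (lam : Node -> Omega -> R)
    (s : Gen -> option Omega -> R) : coordinate -> R :=
  fun v => match v with
  | inl (inl (w, k)) => F w 0 k
  | inl (inr (n, w)) => lam n w
  | inr (i, o) => s i o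
  end.

Lemma flow_assemble F lam s : flow (assemble F lam s) = F.
Proof. by apply/funext => w; apply/rowP => k; rewrite mxE. Qed.

Definition feasible a :=
  [/\ forall w, flows (flow a w), forall n w, 0 <= price a n w <= VOLL &
      forall i, schedules (G i) (schedule a i)].

Definition excess a n w :=
  \sum_(i | j i == n) schedule a i (Some w) + tau n (flow a w) - D n w.

Definition utility a i (s : option Omega -> R) :=
  risk_value (Q i) (profit (c i) (ru i) (rv i) (price a (j i)) (plan_of s)).

(** The three sums belong to the system operator, the market clearing agent and
    the generators. Prices enter the second sum with the opposite sign because
    the market clearing agent minimizes the value of the excess supply. *)
Definition gain a b :=
  \sum_w \sum_n price a n w * (tau n (flow b w) - tau n (flow a w))
  + \sum_w \sum_n (price a n w - price b n w) * excess a n w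
  + \sum_i (utility a i (schedule b i) - utility a i (schedule a i)).

Hypothesis ru_ge0 : forall i, 0 <= ru i.
Hypothesis rv_ge0 : forall i, 0 <= rv i.
Hypothesis G_ge0 : forall i w, 0 <= G i w.
Hypothesis Q_prob : forall i, Q i `<=` @prob_measures R Omega.
Hypothesis Q_closed : forall i, closed (Q i : set {ptws Omega -> R}).
Hypothesis Q_nonempty : forall i, Q i !=set0.

Lemma gain_diag a : gain a a = 0.
Proof.
rewrite /gain !big1 ?addr0 // => [i _|w _|w _]; rewrite ?subrr //.
  by rewrite big1 // => n _; rewrite subrr mul0r.
by rewrite big1 // => n _; rewrite subrr mulr0.
Qed.

Lemma flow_mix (t : R) a b w :
  flow (fun v => t * a v + (1 - t) * b v) w = t *: flow a w + (1 - t) *: flow b w.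
Proof. by apply/rowP => k; rewrite !mxE. Qed.

Lemma gain_concave (t : R) a b b' : 0 <= t <= 1 ->
  t * gain a b + (1 - t) * gain a b' <=
  gain a (fun v => t * b v + (1 - t) * b' v).
Proof.
move=> t01; rewrite /gain !mulrDr addrACA lerD //; first rewrite addrACA lerD //.
- rewrite !mulr_sumr -big_split ler_sum // => w _ /=.
  rewrite !mulr_sumr -big_split ler_sum // => n _ /=.
  rewrite flow_mix linearD !linearZ /= /GRing.scale /= le_eqVlt; apply/orP; left.
  by apply/eqP; ring.
- rewrite !mulr_sumr -big_split ler_sum // => w _ /=.
  rewrite !mulr_sumr -big_split ler_sum // => n _ /=.
  by rewrite /price le_eqVlt; apply/orP; left; apply/eqP; ring.
rewrite !mulr_sumr -big_split ler_sum // => i _ /=.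
rewrite -subr_ge0; set u := utility a i (schedule a i).
have : t * utility a i (schedule b i) + (1 - t) * utility a i (schedule b' i) <=
    utility a i (schedule (fun v => t * b v + (1 - t) * b' v) i).
  apply: le_trans (risk_value_concave (Q_nonempty i) (@Q_closed i) (@Q_prob i)
    _ _ t01) _.
  apply: le_risk_value => // w.
  exact: profit_concave.
by move=> ?; lra.
Qed.

Lemma continuous_tau_flow (U : topologicalType) (a : U -> coordinate -> R) n w :
  (forall v, continuous (a^~ v)) -> continuous (fun u => tau n (flow (a u) w) : R).
Proof.
move=> acts.
rewrite (_ : (fun u => _) = (fun u => \sum_k
    a u (inl (inl (w, k))) * (tau n (delta_mx 0 k) : R))).
  by apply: continuous_sum => k u; apply: cvgM; [exact: acts|exact: cvg_cst].
apply/funext => u; rewrite {1}[flow _ _]row_sum_delta linear_sum.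
by apply: eq_bigr => k _; rewrite linearZ mxE.
Qed.

Lemma gain_continuous (U : topologicalType) (a : U -> coordinate -> R) b :
  (forall v, continuous (a^~ v)) -> continuous (fun u => gain (a u) b).
Proof.
move=> acts.
have pcts n w : continuous (fun u => price (a u) n w) by exact: acts.
have scts i o : continuous (fun u => schedule (a u) i o) by exact: acts.
have ucts (s : U -> Gen -> option Omega -> R) i :
    (forall o, continuous (fun u => s u i o)) ->
    continuous (fun u => utility (a u) i (s u i)).
  move=> sc; apply: (risk_value_continuous (Q_nonempty i) (@Q_closed i) (@Q_prob i)).
  move=> w; apply: (@profit_continuous R Omega _ _ _ U
    (fun u => price (a u) (j i)) (fun u => s u i)); first exact: pcts.
  exact: sc.
have dispatch_cts n w :
    continuous (fun u => \sum_(i | j i == n) schedule (a u) i (Some w)).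
  apply: (@continuous_big R Gen +%R 0 (fun i => j i == n) (@add_continuous R)
    U (index_enum Gen) (fun i u => schedule (a u) i (Some w))) => i _.
  exact: scts.
move=> u; apply: cvgD; first apply: cvgD.
- apply: continuous_sum => w; apply: continuous_sum => n {}u.
  apply: cvgM; first exact: pcts.
  by apply: cvgB; [exact: cvg_cst|exact: continuous_tau_flow].
- apply: continuous_sum => w; apply: continuous_sum => n {}u.
  apply: cvgM; first by apply: cvgB; [exact: pcts|exact: cvg_cst].
  apply: cvgB; last exact: cvg_cst.
  apply: cvgD; last exact: continuous_tau_flow.
  exact: dispatch_cts.
apply: continuous_sum => i {}u; apply: cvgB.
  have := ucts (fun=> schedule b) i; apply=> o; exact: cst_continuous.
by have := ucts (fun u => schedule (a u)) i; apply=> o; exact: scts.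
Qed.

Lemma feasible_convex (t : R) a b : 0 <= t <= 1 ->
  convex_set (flows : set (convex_lmodType 'rV[R]_m)) ->
  feasible a -> feasible b ->
  feasible (fun v => t * a v + (1 - t) * b v).
Proof.
move=> t01 /convex_setP flows_convex [aF ap aS] [bF bp bS]; split.
- by move=> w; rewrite flow_mix; exact: flows_convex.
- move=> n w; rewrite /price; move: (ap n w) (bp n w) t01; rewrite /price.
  by move=> /andP[? ?] /andP[? ?] /andP[? ?]; apply/andP; split; nra.
by move=> i; exact: schedules_convex.
Qed.

Lemma flow_continuous (U : topologicalType) (a : U -> coordinate -> R) w :
  (forall v, continuous (a^~ v)) -> continuous (fun u => flow (a u) w).
Proof.
move=> acts.
rewrite (_ : (fun u => _) = (fun u => \sum_k
    a u (inl (inl (w, k))) *: (delta_mx 0 k : 'rV[R]_m))).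
  apply: (@continuous_big 'rV[R]_m 'I_m +%R 0 xpredT (@add_continuous 'rV[R]_m)
    U (index_enum 'I_m) (fun k u => a u (inl (inl (w, k))) *: delta_mx 0 k)).
  by move=> k _ u; apply: cvgZr_tmp; exact: acts.
apply/funext => u; rewrite [LHS]row_sum_delta.
by apply: eq_bigr => k _; rewrite mxE.
Qed.

Lemma feasible_closed (U : topologicalType) (a : U -> coordinate -> R) :
  (forall v, continuous (a^~ v)) -> closed flows ->
  closed [set u | feasible (a u)].
Proof.
move=> acts flows_closed.
have closed_forall (I : Type) (P : I -> set U) :
    (forall i, closed (P i)) -> closed [set u | forall i, P i u].
  move=> Pcl; rewrite (_ : [set u | _] = \bigcap_(i in [set: I]) P i).
    exact: closed_bigI.
  by apply/seteqP; split=> u Pu i; [move=> _|]; exact: Pu.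
have closed_itv (f : U -> R) x : continuous f -> closed [set u | 0 <= f u <= x].
  move=> fcts; rewrite (_ : [set u | _] =
    f @^-1` [set y | 0 <= y] `&` f @^-1` [set y | y <= x]); last first.
    by apply/seteqP; split=> u /=; [move/andP|move=> [-> ->]].
  by apply: closedI; apply: preimage_closed;
    [move=> u _; exact: fcts|exact: closed_ge
    |move=> u _; exact: fcts|exact: closed_le].
rewrite (_ : [set u | _] = [set u | forall w, flows (flow (a u) w)] `&`
    [set u | forall n w, 0 <= price (a u) n w <= VOLL] `&`
    [set u | forall i, schedules (G i) (schedule (a u) i)]); last first.
  by apply/seteqP; split=> u [] // [].
apply: closedI; first apply: closedI.
- apply: (closed_forall _ (fun w => (fun u => flow (a u) w) @^-1` flows)) => w.
  by apply: preimage_closed flows_closed => u _; exact: flow_continuous.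
- apply: (closed_forall _
    (fun n => [set u | forall w, 0 <= price (a u) n w <= VOLL])) => n.
  apply: (closed_forall _
    (fun w => [set u | 0 <= price (a u) n w <= VOLL])) => w.
  by apply: (closed_itv (fun u => price (a u) n w)); exact: acts.
apply: (closed_forall _
  (fun i => [set u | schedules (G i) (schedule (a u) i)])) => i.
apply: (@closedI _ [set u | 0 <= schedule (a u) i None <= \sum_w G i w]
  [set u | forall w, 0 <= schedule (a u) i (Some w) <= G i w]).
  by apply: (closed_itv (fun u => schedule (a u) i None)); exact: acts.
apply: (closed_forall _
  (fun w => [set u | 0 <= schedule (a u) i (Some w) <= G i w])) => w.
by apply: (closed_itv (fun u => schedule (a u) i (Some w))); exact: acts.
Qed.

(** Replacing the part of one agent (in one scenario, for the operator and the
    market) leaves a feasible profile, and all but one term of the gain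
    vanish. For a generator, an arbitrary plan is first replaced by the
    schedule that dominates it. *)
Lemma equilibrium_of_gain a : feasible a ->
  (forall b, feasible b -> gain a b <= 0) ->
  RAEQ_solution j flows tau c ru rv G D Q VOLL
    (flow a) (price a) (fun i => plan_of (schedule a i)).
Proof.
move=> aK no_gain; have [aF ap aS] := aK; split=> [w|w|i].
- split=> [//|F' F'flows].
  pose b := assemble (fun w' => if w' == w then F' else flow a w')
    (price a) (schedule a).
  have bK : feasible b.
    by split=> //; rewrite /b flow_assemble => w'; case: ifP.
  have := no_gain b bK; rewrite /gain /b flow_assemble.
  rewrite (bigD1 w) //= eqxx [X in _ + X + _ + _]big1 => [|w' /negPf w'w].
    rewrite [X in _ + X + _]big1 => [|w' _]; last first.
      by rewrite big1 // => n _; rewrite subrr mul0r.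
    rewrite [X in _ + X]big1 => [|i _]; last exact: subrr.
    rewrite !addr0; under eq_bigr do rewrite mulrBr.
    by rewrite sumrB subr_le0.
  by rewrite w'w big1 // => n _; rewrite subrr mulr0.
- split=> [n /=|l l_itv]; first exact: ap.
  pose b := assemble (flow a) (fun n w' => if w' == w then l n else price a n w')
    (schedule a).
  have bK : feasible b.
    split; rewrite /b ?flow_assemble // => n w'; rewrite /price /=.
    by case: ifP => _; [exact: l_itv|exact: ap].
  have := no_gain b bK; rewrite /gain /b flow_assemble.
  rewrite big1 => [|w' _]; last by rewrite big1 // => n _; rewrite subrr mulr0.
  rewrite [X in _ + X]big1 => [|i _]; last exact: subrr.
  rewrite add0r addr0 (bigD1 w) //= [X in _ + X]big1 => [|w' /negPf w'w]; last first.
    by rewrite big1 // => n _; rewrite /price /= w'w subrr mul0r.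
  rewrite addr0 /price /= eqxx; under eq_bigr do rewrite mulrBl.
  by rewrite sumrB subr_le0 lerN2.
split=> [|p' p'feas]; first exact: plan_of_feasible.
have [s sK s_dom] := plan_of_dominates (c i) (ru_ge0 i) (rv_ge0 i) (G_ge0 i)
  (price a (j i)) p'feas.
apply: (@le_trans _ _ (utility a i s)); first exact: le_risk_value.
pose b := assemble (flow a) (price a)
  (fun i' => if i' == i then s else schedule a i').
have bK : feasible b.
  split; rewrite /b ?flow_assemble // => i'; rewrite /schedule /=.
  by case: eqP => [->|_] //; exact: aS.
have := no_gain b bK; rewrite /gain /b flow_assemble.
rewrite big1 => [|w' _]; last by rewrite big1 // => n _; rewrite subrr mulr0.
rewrite [X in _ + X + _]big1 => [|w' _]; last first.
  by rewrite big1 // => n _; rewrite subrr mul0r.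
rewrite !add0r (bigD1 i) //= [X in _ + X]big1 => [|i' /negPf i'i]; last first.
  by rewrite /schedule /= i'i subrr.
by rewrite addr0 /schedule /= eqxx subr_le0.
Qed.
End Market.

(** * Ky Fan's inequality in coordinates *)

Section Coordinates.
Variables (R : realType) (V : finType).

Definition of_row (z : 'rV[R]_#|V|) : V -> R := fun v => z 0 (enum_rank v).
Definition to_row (a : V -> R) : 'rV[R]_#|V| := \row_k a (enum_val k).

Lemma to_rowK : cancel to_row of_row.
Proof. by move=> a; apply/funext => v; rewrite /of_row mxE enum_rankK. Qed.

Lemma of_row_continuous v : continuous (of_row^~ v).
Proof. exact: coord_continuous. Qed.

(** Row vectors give the functions a norm; compactness then comes from
    closedness and the coordinatewise bounds B, and concavity of phi in the
    second argument makes the sets of positivity convex. *)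
Lemma ky_fan_coordinates (K : set (V -> R)) (B : V -> R)
    (phi : (V -> R) -> (V -> R) -> R) :
  closed (of_row @^-1` K) -> K !=set0 ->
  (forall a v, K a -> `|a v| <= B v) ->
  (forall (t : R) a b, 0 <= t <= 1 -> K a -> K b ->
     K (fun v => t * a v + (1 - t) * b v)) ->
  (forall b, K b -> continuous (fun z => phi (of_row z) b)) ->
  (forall (t : R) a b b', 0 <= t <= 1 -> K a ->
     t * phi a b + (1 - t) * phi a b' <=
     phi a (fun v => t * b v + (1 - t) * b' v)) ->
  (forall a, K a -> phi a a <= 0) ->
  exists2 a, K a & forall b, K b -> phi a b <= 0.
Proof.
move=> Kclosed [a0 Ka0] Kbnd Kcvx phi_cts phi_ccv phi_diag.
have of_row_mix (t : R) x y : of_row (t *: x + (1 - t) *: y) =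
    (fun v => t * of_row x v + (1 - t) * of_row y v).
  by apply/funext => v; rewrite /of_row !mxE.
have Kco : compact (of_row @^-1` K).
  apply: (@subclosed_compact _ _ [set z : 'rV[R]_#|V| |
    forall k, `[- B (enum_val k), B (enum_val k)]%classic (z ord0 k)]) => //.
    exact: (@rV_compact R _ (fun k => `[- B (enum_val k), B (enum_val k)]%classic)
      (fun k => @segment_compact R _ _)).
  move=> z Kz k /=; rewrite in_itv /= -ler_norml.
  by have := Kbnd _ (enum_val k) Kz; rewrite /of_row enum_valK.
have [|||x Kx|x Kx|x Kx x_opt] := @ky_fan R _ (of_row @^-1` K)
  (fun x y => phi (of_row x) (of_row y)) Kco.
- by exists (to_row a0); rewrite /= to_rowK.
- apply/convex_setP => t x y t01 Kx Ky; rewrite /= of_row_mix; exact: Kcvx.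
- by move=> y Ky; exact: phi_cts.
- apply/convex_setP => t y y' t01 [Ky y_gt0] [Ky' y'_gt0].
  rewrite /= of_row_mix; split; first exact: Kcvx.
  apply: lt_le_trans (phi_ccv _ _ _ _ t01 Kx).
  move: t01 => /andP[t0 t1]; have [->|t_neq0] := eqVneq t 0.
    by rewrite mul0r add0r subr0 mul1r.
  have {}t0 : 0 < t by rewrite lt_neqAle eq_sym t_neq0.
  by rewrite ltr_pwDl ?mulr_gt0 // mulr_ge0 ?subr_ge0 // ltW.
- exact: phi_diag.
exists (of_row x) => // b Kb; rewrite -[b]to_rowK.
by apply: x_opt; rewrite /= to_rowK.
Qed.
End Coordinates.

(** * Existence of an equilibrium *)

Theorem theorem7 (R : realType) (Omega Node Gen : finType)
    (j : Gen -> Node) (m : nat)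
    (flows : set 'rV[R]_m) (tau : Node -> {linear 'rV[R]_m -> R^o})
    (c ru rv : Gen -> R) (G : Gen -> Omega -> R) (D : Node -> Omega -> R)
    (Q : Gen -> set (Omega -> R)) (VOLL : R)
    (flows_closed : closed flows)
    (flows_convex : convex_set (flows : set (convex_lmodType 'rV[R]_m)))
    (flows_bounded : bounded_set flows)
    (flows_nonempty : flows !=set0)
    (ru_ge0 : forall i, 0 <= ru i)
    (rv_ge0 : forall i, 0 <= rv i)
    (G_ge0 : forall i w, 0 <= G i w)
    (Q_prob : forall i, Q i `<=` @prob_measures R Omega)
    (Q_closed : forall i, closed (Q i : set {ptws Omega -> R}))
    (Q_convex : forall i,
       convex_set (Q i : set (convex_lmodType (Omega -> R^o))))
    (Q_nonempty : forall i, Q i !=set0)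
    (VOLL_ge0 : 0 <= VOLL) :
  exists (F : Omega -> 'rV[R]_m) (lam : Node -> Omega -> R)
         (p : Gen -> plan R Omega),
    RAEQ_solution j flows tau c ru rv G D Q VOLL F lam p.
Proof.
pose K : set (coordinate Omega Node Gen m -> R) := feasible flows G VOLL.
pose phi := gain j tau c ru rv D Q.
have [F0 F0flows] := flows_nonempty.
have [M flowsM] : exists M, forall F, flows F -> forall k, `|F 0 k| <= M.
  have [M [_ normM]] := flows_bounded; exists (M + 1) => F Fflows k.
  apply: le_trans (normM (M + 1) _ F Fflows); last by rewrite ltrDl.
  rewrite [leRHS]/Num.norm /= mx_normrE; apply/bigmax_geP; right => /=.
  by exists (0, k).
pose B (v : coordinate Omega Node Gen m) := match v with
  | inl (inl _) => M | inl (inr _) => VOLL | inr (i, _) => \sum_w G i w end.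
have [|||||||a Ka a_opt] := @ky_fan_coordinates R _ K B phi.
- by apply: feasible_closed => // v; exact: of_row_continuous.
- exists (assemble (fun=> F0) (fun _ _ => 0) (fun _ _ => 0)); split.
  + by rewrite flow_assemble.
  + by move=> n w; rewrite /price /= lexx.
  + by move=> i; split=> [|w]; rewrite /schedule /= lexx ?sumr_ge0 ?G_ge0.
- move=> a v [aF ap aS]; case: v => [[[w k]|[n w]]|[i o]] /=.
  + by have := flowsM _ (aF w) k; rewrite mxE.
  + by have /andP[? ?] := ap n w; rewrite ger0_norm.
  have [/andP[n0 nM] sG] := aS i; case: o => [w|]; last by rewrite ger0_norm.
  have /andP[s0 sGw] := sG w; rewrite ger0_norm // (le_trans sGw) //.
  by rewrite (bigD1 w) //= lerDl sumr_ge0.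
- by move=> t a b t01; exact: feasible_convex.
- by move=> b _; apply: gain_continuous => // v; exact: of_row_continuous.
- by move=> t a b b' t01 _; exact: gain_concave.
- by move=> a _; rewrite /phi gain_diag.
exists (flow a), (price a), (fun i => plan_of (schedule a i)).
exact: equilibrium_of_gain.
Qed.
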